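(* A Hausdorff space $X$ is $\aleph_0H'$-closed if and only if $X$ is H-closed.
   Context: A Hausdorff space $X$ is H-closed if every open cover $\mathcal V$ of $X$ has a finite subfamily $\mathcal W$ with $X=\bigcup_{W\in\mathcal W}cl\,W$. An open ultrafilter on a Hausdorff space $X$ is a maximal filter in the family of open subsets of $X$ (its members are nonempty open sets); it converges to $x\in X$ if it contains every open set containing $x$. $EX$ is the set of all convergent open ultrafilters on $X$. A section is a function $b:X\to EX$ such that $b(x)$ converges to $x$ for every $x\in X$. For a section $b$ and an open set $U$ let $\widehat{U}_b=\{x\in X: U\in b(x)\}$, and for $A\subseteq X$ let $c_b(A)=\{x\in X:\widehat{U}_b\cap A\neq\varnothing\text{ for every open }U\ni x\}$. $A$ is $c_b$-closed if $c_b(A)=A$. For $A\subseteq X$, $aL(A,X)$ is the least infinite cardinal $\kappa$ such that every cover $\mathcal V$ of $A$ by open sets of $X$ has a subfamily $\mathcal W$ with $|\mathcal W|\leq\kappa$ and $A\subseteq\bigcup_{W\in\mathcal W}cl\,W$. Put $aL^b(X)=\sup\{aL(C,X): C\text{ is }c_b\text{-closed}\}+\aleph_0$ and $aL'(X)=\min\{aL^b(X): b\text{ a section}\}$. Fix any section $b'$ with $aL^{b'}(X)=aL'(X)$ and write $\widehat{U}=\widehat{U}_{b'}$. Let $\kappa$ be an infinite cardinal. For $A\subseteq X$ with $|A|\geq\kappa$ let $c^\kappa(A)=\{x\in X: |\widehat{U}\cap A|\geq\kappa\text{ for every open }U\ni x\}$. $X$ is $\kappa H'$-closed if for every $A\subseteq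 X$ with $|A|\geq\kappa$ and every family $\mathcal U$ of open sets of $X$ covering $c^\kappa(A)$ there is a finite $\mathcal V\subseteq\mathcal U$ with $|A\setminus\bigcup_{V\in\mathcal V}\widehat{V}|<\kappa$. (In particular, $X$ is $\kappa H'$-closed if $|X|<\kappa$.) *)

(* Defs.v *)
From HB Require Import structures.
From mathcomp Require Import all_boot all_order.
From mathcomp Require Import boolp classical_sets functions cardinality.
From mathcomp Require Import topology.

Set Implicit Arguments.
Unset Strict Implicit.
Unset Printing Implicit Defensive.

Local Open Scope classical_set_scope.
Local Open Scope card_scope.

(* Cardinals are represented by types, compared with #<= and #= on their full
   sets.  The minimum of a class P of cardinals is a member of P that embeds
   into every other one; it exists if P is nonempty (card_minP), and the value
   nat in the remaining case is junk. *)
Definition is_card_min (P : Type -> Prop) (K : Type) : Prop :=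
  P K /\ forall L : Type, P L -> [set: K] #<= [set: L].

Definition card_min (P : Type -> Prop) : Type :=
  if pselect (exists K : Type, is_card_min P K) is left e
  then sval (cid e) else nat.

Definition is_card_ub (S : Type -> Prop) (K : Type) : Prop :=
  forall L : Type, S L -> [set: L] #<= [set: K].

Definition card_sup (S : Type -> Prop) : Type := card_min (is_card_ub S).

Lemma inj_card_leT (T U : Type) (f : T -> U) :
  injective f -> [set: T] #<= [set: U].
Proof.
move=> fI; have fI' : {in [set: T] &, injective f} by move=> x y _ _; apply: fI.
by rewrite -(card_le_eql (inj_card_eq fI')); apply: card_leT.
Qed.

Lemma card_family_min (I : Type) (F : I -> Type) (k : I) :
  exists i, forall j, [set: F i] #<= [set: F j].
Proof.
pose inj_on (S : set (forall i : I, F i)) :=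
  forall i s t, S s -> S t -> s i = t i -> s = t.
have [S [SP Smax]] : exists S, inj_on S /\ forall S', S `<` S' -> ~ inj_on S'.
  apply: Zorn_bigcup => C CP Ctot i s t [A CA As] [B CB Bt].
  case: (Ctot _ _ CA CB) => AB.
    exact: (CP _ CB i s t (AB _ As) Bt).
  exact: (CP _ CA i s t As (AB _ Bt)).
have [i0 i0surj] : exists i : I, forall y : F i, exists2 s, S s & s i = y.
  apply: contrapT => H.
  have /(_ _)/cid-/all_sig[f fS] i :
      exists y : F i, forall s, S s -> s i <> y.
    apply: contrapT => Hi; apply: H; exists i => y.
    apply: contrapT => Hy; apply: Hi; exists y => s Ss sy.
    by apply: Hy; exists s.
  apply: (Smax (S `|` [set f])).
    split; first by move=> s; left.
    by move=> /(_ f (or_intror erefl)) Sf; apply: (fS k f Sf).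
  move=> i s t [Ss|->] [St|->] // st; first exact: SP st.
    by have := fS i s Ss.
  by have := fS i t St; rewrite st.
exists i0 => j.
have /(_ _)/cid2-/all_sig2[g gS gE] := i0surj.
apply: (@inj_card_leT _ _ (fun y => g y j)) => y z yz.
by rewrite -(gE y) -(gE z) (SP _ _ _ (gS y) (gS z) yz).
Qed.

Lemma card_minP (P : Type -> Prop) (T : Type) :
  P T -> is_card_min P (card_min P).
Proof.
move=> PT; rewrite /card_min; case: pselect => [e|[]]; first by case: cid.
pose I := {A : set T | exists2 K : Type, P K & [set: K] #= A}.
have TI : exists2 K : Type, P K & [set: K] #= [set: T].
  by exists T => //; rewrite card_eqxx.
have /(_ _)/cid2-/all_sig2[K PK KA] := fun i : I => svalP i.
have [i Kmin] := card_family_min K (exist _ _ TI).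
have sub (L : Type) : P L -> [set: L] #<= [set: T] -> [set: K i] #<= [set: L].
  move=> PL /card_subP[B BL _]; have BI : exists2 K : Type, P K & [set: K] #= B.
    by exists L => //; rewrite card_eq_sym.
  apply: card_le_trans (Kmin (exist _ _ BI)) _.
  by rewrite (card_le_eql (KA _)) /= (card_le_eql BL) card_lexx.
exists (K i); split=> // L PL.
have [b bP] := card_family_min (fun b : bool => if b then T else L) true.
case: b bP => bP; last exact: sub PL (bP true).
exact: card_le_trans (sub T PT (card_lexx _)) (bP false).
Qed.

Section Spaces.
Variable X : topologicalType.
Implicit Types (A : set X) (U : set X) (b : X -> set (set X)).

Definition H_closed : Prop :=
  forall V : set (set X), V `<=` open -> \bigcup_(U in V) U = [set: X] ->
  exists W : set (set X),
    [/\ W `<=` V, finite_set W & \bigcup_(U in W) closure U = [set: X]].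

Record open_filter (F : set (set X)) : Prop := OpenFilter {
  open_filter_open : F `<=` open ;
  open_filter_nonempty : forall U, F U -> U !=set0 ;
  open_filterT : F [set: X] ;
  open_filterI : forall U V, F U -> F V -> F (U `&` V) ;
  open_filterS : forall U V, F U -> open V -> U `<=` V -> F V }.

Definition open_ultrafilter (F : set (set X)) : Prop :=
  open_filter F /\
  forall G : set (set X), open_filter G -> F `<=` G -> G = F.

Definition open_converges (F : set (set X)) (x : X) : Prop :=
  forall U, open U -> U x -> F U.

Definition EX : set (set (set X)) :=
  [set F | open_ultrafilter F /\ exists x, open_converges F x].

Definition is_section b : Prop :=
  forall x, EX (b x) /\ open_converges (b x) x.

Definition hat b U : set X := [set x | b x U].

Definition c_closure b A : set X :=
  [set x | forall U, open U -> U x -> hat b U `&` A !=set0].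

Definition c_closed b A : Prop := c_closure b A = A.

Definition aL_bound A (K : Type) : Prop :=
  infinite_set [set: K] /\
  forall V : set (set X), V `<=` open -> A `<=` \bigcup_(U in V) U ->
  exists W : set (set X),
    [/\ W `<=` V, W #<= [set: K] & A `<=` \bigcup_(U in W) closure U].

Definition aL A : Type := card_min (aL_bound A).

Definition aLb b : Type :=
  (card_sup (fun K => exists2 C, c_closed b C & K = aL C) + nat)%type.

Definition aL' : Type :=
  card_min (fun K => exists2 b, is_section b & K = aLb b).

Definition minimal_section b : Prop :=
  is_section b /\ [set: aLb b] #= [set: aL'].

(* |A| >= kappa is [set: kappa] #<= A, and |A| < kappa is its negation. *)
Definition c_kappa (kappa : Type) b A : set X :=
  [set x | forall U, open U -> U x -> [set: kappa] #<= (hat b U `&` A)].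

Definition kappaH'_closed (kappa : Type) b : Prop :=
  forall A, [set: kappa] #<= A ->
  forall UU : set (set X), UU `<=` open ->
  c_kappa kappa b A `<=` \bigcup_(U in UU) U ->
  exists VV : set (set X),
    [/\ VV `<=` UU, finite_set VV &
        ~ ([set: kappa] #<= A `\` \bigcup_(V in VV) hat b V)].

(* The minima and suprema above range over nonempty classes, so that card_minP
   applies to each of them, and minimal sections exist. *)
Lemma aL_bound_ex A (K : Type) :
  infinite_set [set: K] -> [set: X] #<= [set: K] -> aL_bound A K.
Proof.
move=> Kinf XK; split=> // V Vo AV.
have /(_ _)/cid-/all_sig[f fE] (x : X) :
    exists U, A x -> V U /\ U x.
  have [/AV[U VU Ux]|nA] := pselect (A x); first by exists U.
  by exists set0.
exists (f @` A); split.
- by move=> _ [x Ax <-]; case: (fE x Ax).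
- apply: card_le_trans (card_image_le _ _) _.
  exact: card_le_trans (card_leT _) XK.
- move=> x Ax; exists (f x); first by exists x.
  by apply: subset_closure; case: (fE x Ax).
Qed.

Lemma infinite_sum_nat (T : Type) : infinite_set [set: (T + nat)%type].
Proof. by apply/infiniteP/(@inj_card_leT _ _ inr) => m n []. Qed.

Lemma card_le_sum_nat (T : Type) : [set: T] #<= [set: (T + nat)%type].
Proof. by apply: (@inj_card_leT _ _ inl) => m n []. Qed.

Lemma aLP A : is_card_min (aL_bound A) (aL A).
Proof.
apply: (@card_minP _ (X + nat)%type).
by apply: aL_bound_ex (card_le_sum_nat _); exact: infinite_sum_nat.
Qed.

Lemma aL_supP b :
  let S K := exists2 C, c_closed b C & K = aL C in
  is_card_min (is_card_ub S) (card_sup S).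
Proof.
apply: (@card_minP _ (X + nat)%type) => _ [C _ ->].
apply: (aLP C).2; apply: aL_bound_ex (card_le_sum_nat _).
exact: infinite_sum_nat.
Qed.

Lemma open_ultrafilter_ex (x : X) :
  exists F, open_ultrafilter F /\ open_converges F x.
Proof.
pose N : set (set X) := [set U | open U /\ U x].
pose P (F : set (set X)) := F = set0 \/ open_filter F /\ N `<=` F.
have Nf : open_filter N.
  split; rewrite /N /=.
  - by move=> U [].
  - by move=> U [_ Ux]; exists x.
  - by split=> //; exact: openT.
  - by move=> U V [oU Ux] [oV Vx]; split=> //; exact: openI.
  - by move=> U V [_ Ux] oV UV; split=> //; exact: UV.
have [F [PF Fmax]] : exists F, P F /\ forall G, F `<` G -> ~ P G.
  apply: Zorn_bigcup => C CP Ctot.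
  have [[F0 CF0 F0n]|none] := pselect (exists2 F, C F & F <> set0); last first.
    left; rewrite -subset0 => U [F CF FU].
    by apply: none; exists F => // F0; rewrite F0 in FU.
  have CP' F U : C F -> F U -> open_filter F /\ N `<=` F.
    by move=> /CP[->|].
  have [F0f NF0] : open_filter F0 /\ N `<=` F0 by have [] := CP _ CF0.
  right; split; last by move=> U /NF0 FU; exists F0.
  split.
  - by move=> U [F CF FU]; apply: (open_filter_open (CP' _ _ CF FU).1).
  - by move=> U [F CF FU]; apply: (open_filter_nonempty (CP' _ _ CF FU).1).
  - by exists F0 => //; exact: open_filterT.
  - move=> U V [F CF FU] [G CG GV]; case: (Ctot _ _ CF CG) => FG.
      exists G => //; apply: (open_filterI (CP' _ _ CG GV).1) => //.
      exact: FG.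
    exists F => //; apply: (open_filterI (CP' _ _ CF FU).1) => //.
    exact: FG.
  - move=> U V [F CF FU] oV UV; exists F => //.
    exact: (open_filterS (CP' _ _ CF FU).1) FU oV UV.
have [F0|[Ff NF]] := PF.
  exfalso; apply: (Fmax N); last by right; split=> //; exact: subset_refl.
  rewrite F0; split; first exact: sub0set.
  by move=> /(_ setT); apply; exact: open_filterT.
exists F; split; last by move=> U oU Ux; apply: NF.
split=> // G Gf FG; apply: contrapT => GF; apply: (Fmax G); last first.
  by right; split=> //; exact: subset_trans FG.
by split=> // GF'; apply: GF; apply/seteqP.
Qed.

Lemma minimal_section_ex : exists b, minimal_section b.
Proof.
have /(_ _)/cid-/all_sig[b bP] := open_ultrafilter_ex.
have bS : is_section b.
  by move=> x; case: (bP x) => bu bc; split=> //; split=> //; exists x.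
have [] : is_card_min (fun K => exists2 b, is_section b & K = aLb b) aL'.
  by apply: (@card_minP _ (aLb b)); exists b.
move=> [b' b'S b'E] _; exists b'; split=> //.
by rewrite b'E card_eqxx.
Qed.

End Spaces.

Arguments H_closed X : clear implicits.
Arguments aL' X : clear implicits.

(* Main.v *)
Require Import Defs.
From mathcomp Require Import all_boot all_order.
From mathcomp Require Import boolp classical_sets functions cardinality.
From mathcomp Require Import topology.

(** The set [hat b U] lies between [U] and [closure U]. For a finite family of
open sets the closures cover [X] iff the hats do: if [x] is in no hat, the open
ultrafilter [b x] has a member disjoint from every set of the family, hence
from every closure. H-closedness therefore yields a finite family whose hats
cover [X], and the points outside [c_kappa nat b A] have neighbourhoods whose
hats meet [A] in a finite set. *)

Set Implicit Arguments.
Unset Strict Implicit.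
Unset Printing Implicit Defensive.

Local Open Scope classical_set_scope.
Local Open Scope card_scope.

Lemma not_card_le_nat T (A : set T) : ~ ([set: nat] #<= A) <-> finite_set A.
Proof.
rewrite -infiniteP; split=> [/contrapT //|fA]; exact.
Qed.

Section OpenUltrafilters.
Variable X : topologicalType.
Implicit Types (U V G : set X) (F W : set (set X)) (x : X).

(** By maximality: [U] and [F] together generate an open filter extending [F], which must then be
    [F] itself. *)
Lemma open_ultrafilter_meets F U : open_ultrafilter F -> open U ->
  (forall G, F G -> U `&` G !=set0) -> F U.
Proof.
move=> [Ff Fmax] oU UF.
suff <- : [set V | open V /\ exists2 G, F G & U `&` G `<=` V] = F.
  split=> //; exists [set: X]; first exact: open_filterT Ff.
  exact: subIsetl.
apply: Fmax; last first.
  move=> V FV; split; first exact: (open_filter_open Ff FV).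
  by exists V => //; exact: subIsetr.
split.
- by move=> V [].
- by move=> V [_ [G /UF[y UGy] GV]]; exists y; exact: GV.
- by split; [exact: openT | exists [set: X] => //; exact: open_filterT Ff].
- move=> V V' [oV [G FG GV]] [oV' [G' FG' GV']]; split; first exact: openI.
  exists (G `&` G'); first exact: (open_filterI Ff FG FG').
  by move=> y [Uy [Gy G'y]]; split; [exact: GV | exact: GV'].
- move=> V V' [_ [G FG GV]] oV' VV'; split=> //.
  by exists G => //; exact: subset_trans VV'.
Qed.

Lemma open_ultrafilter_finite_cover F W : open_ultrafilter F ->
  W `<=` open -> finite_set W -> \bigcup_(U in W) closure U = [set: X] ->
  exists2 U, W U & F U.
Proof.
move=> Fu Wo /finite_seqP[s Ws] Wcov; apply: contrapT => WF.
(* Each [U] outside the ultrafilter misses some member of [F]; intersecting these along the list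
   gives one [G] that misses them all. *)
have [G FG GW] : exists2 G, F G & forall U, U \in s -> U `&` G = set0.
  have : forall U, U \in s -> open U /\ ~ F U.
    move=> U Us; have WU : W U by rewrite Ws.
    by split; [exact: Wo | move=> FU; apply: WF; exists U].
  elim: {Ws} s => [_|U s IHs sF].
    by exists [set: X] => //; exact: open_filterT Fu.1.
  have [V Vs|G FG Gs] := IHs; first by apply: sF; rewrite inE Vs orbT.
  have [oU nFU] := sF U (mem_head _ _).
  have [G' FG' UG'] : exists2 G', F G' & U `&` G' = set0.
    apply: contrapT => nG; apply: nFU; apply: open_ultrafilter_meets => // G' FG'.
    by apply/set0P/eqP => UG'; apply: nG; exists G'.
  exists (G `&` G'); first exact: (open_filterI Fu.1 FG FG').
  move=> V; rewrite inE => /orP[/eqP->|Vs].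
    by rewrite setICA UG' setI0.
  by rewrite setIA Gs // set0I.
have [y Gy] := open_filter_nonempty Fu.1 FG.
have [U WU Uy] : (\bigcup_(U in W) closure U) y by rewrite Wcov.
(* [G] is an open neighbourhood of [y], and [y] is in the closure of [U]. *)
have [z UGz] : U `&` G !=set0.
  apply: Uy; apply: open_nbhs_nbhs; split=> //.
  exact: (open_filter_open Fu.1 FG).
suff : set0 z by [].
by rewrite -(GW U) //; move: WU; rewrite Ws.
Qed.

Variable b : X -> set (set X).
Hypothesis bS : is_section b.

(** Both [U] and every open neighbourhood of [x] belong to the filter [b x], so they intersect. *)
Lemma hat_sub_closure U : hat b U `<=` closure U.
Proof.
move=> x Ux N; rewrite nbhsE => -[O [oO Ox] ON].
have [[[bf _] _] bc] := bS x.
have [y [Uy Oy]] :=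
  open_filter_nonempty bf (open_filterI bf Ux (bc _ oO Ox)).
by exists y; split=> //; exact: ON.
Qed.

Lemma kappaH'_closed_H_closed : kappaH'_closed nat b -> H_closed X.
Proof.
move=> bH V Vo Vcov.
have [W [WV Wfin Wcov]] : exists W, [/\ W `<=` V, finite_set W &
    finite_set (~` \bigcup_(U in W) hat b U)].
  (* The hypothesis speaks of infinite sets only, so it is used with [A] the whole space; if [X] is
     finite, the empty family will do. *)
  have [Xinf|Xfin] := pselect ([set: nat] #<= [set: X]).
    have [|W [WV Wfin Wcov]] := bH _ Xinf V Vo; first by rewrite Vcov.
    by exists W; split=> //; rewrite -setTD; exact/not_card_le_nat.
  exists set0; split; [exact: sub0set | exact: finite_set0 |].
  by apply: sub_finite_set (@subsetT _ _) _; exact/not_card_le_nat.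
have /(_ _)/cid2-/all_sig2[f Vf fx] x : (\bigcup_(U in V) U) x by rewrite Vcov.
set R := ~` _ in Wcov.
(* The finitely many points of [R], in no hat, are each covered by one chosen member of [V]. *)
exists (W `|` f @` R); split.
- by move=> U [/WV //|[x _ <-]]; exact: Vf.
- by rewrite finite_setU; split=> //; exact: finite_image.
- apply/seteqP; split=> // x _; have [[U WU Ux]|Rx] :=
    pselect ((\bigcup_(U in W) hat b U) x).
    by exists U; [left | exact: hat_sub_closure].
  exists (f x); first by right; exists x.
  exact/subset_closure/fx.
Qed.

Lemma H_closed_kappaH'_closed : H_closed X -> kappaH'_closed nat b.
Proof.
move=> XH A _ UU UUo Acov.
(* A point outside [c_kappa nat b A] has a neighbourhood in [S], so [S] completes [UU] to a cover of
   [X]. *)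
pose S := [set U | open U /\ finite_set (hat b U `&` A)].
have [||W [WV Wfin Wcov]] := XH (UU `|` S).
- by move=> U [/UUo //|[]].
- apply/seteqP; split=> // x _.
  have [/Acov[U UUU Ux]|nAx] := pselect (c_kappa nat b A x).
    by exists U => //; left.
  have [U [oU Ux Ufin]] :
      exists U, [/\ open U, U x & ~ ([set: nat] #<= hat b U `&` A)].
    apply: contrapT => nU; apply: nAx => U oU Ux; apply: contrapT => Ufin.
    by apply: nU; exists U.
  by exists U => //; right; split=> //; exact/not_card_le_nat.
have Wo : W `<=` open by move=> U /WV[/UUo //|[]].
exists (W `&` UU); split; first exact: subIsetr.
  exact: finite_setIl.
apply/not_card_le_nat.
(* The hats of [W] cover [X], so a point of [A] in no hat from [UU] lies in the hat of some member
   of [S], and each such hat meets [A] in a finite set. *)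
apply: (@sub_finite_set _ _ (\bigcup_(U in W `&` S) (hat b U `&` A))); last first.
  by apply: bigcup_finite; [exact: finite_setIl | move=> U [_ []]].
move=> x [Ax nx]; have [[bu _] _] := bS x.
have [U WU Ux] := open_ultrafilter_finite_cover bu Wo Wfin Wcov.
exists U => //; split=> //; case: (WV _ WU) => // UUU.
by case: nx; exists U.
Qed.

End OpenUltrafilters.

Theorem proposition5p13 (X : topologicalType) (hX : hausdorff_space X)
    (b' : X -> set (set X)) (hb' : minimal_section b') :
  kappaH'_closed nat b' <-> H_closed X.
Proof.
have [bS _] := hb'; split; first exact: kappaH'_closed_H_closed.
exact: H_closed_kappaH'_closed.
Qed.
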